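(* Let $\Sigma$ be a compact GCAT(1) space of dimension $\ge 1$. For $\lambda\ge1$, let $K$ be the Euclidean cone over $\lambda\Sigma$, which is a GCAT(0) space. If $\lambda\ge3/2$, then the vertex of $K$ is a strongly extremal point of $K$. Furthermore, if $\lambda\ge2$, then the vertex of $K$ is a maximally extremal point of $K$.
   Context: A CAT($\kappa$) space is a complete metric space in which any two points at distance $<\pi/\sqrt\kappa$ are joined by a shortest path and any geodesic triangle of perimeter $<2\pi/\sqrt\kappa$ is not thicker than its comparison triangle in the model plane of constant curvature $\kappa$ ($\pi/\sqrt\kappa=\infty$ if $\kappa\le0$). A geodesic is a locally shortest path. A GCAT($\kappa$) space is a separable, locally compact CAT($\kappa$) space that is geodesically complete, i.e. every geodesic is infinitely extendable as a geodesic. A $0$-dimensional compact GCAT(1) space is a finite set, not a singleton, with pairwise distances $\pi$. Dimension means Hausdorff dimension. $\lambda\Sigma$ denotes $\Sigma$ with its metric multiplied by $\lambda$. For a point $p$ of a GCAT space (or, more generally, of a separable, locally compact, locally geodesically complete space with curvature locally bounded above), $\Sigma_p$ denotes the space of directions at $p$, with the angle metric truncated at $\pi$; it is a compact GCAT(1) space. For the vertex of $K$, this is $\lambda\Sigma$ with its metric truncated at $\pi$. For $\xi,\eta$ in a compact GCAT(1) space $\Sigma$ (metric truncated at $\pi$), the antipodal distance is $\overline{|\xi\eta|}:=\max_{x\in\Sigma}(|\xi x|+|\eta x|)-\pi=\max\{|\bar\xi\eta|:\bar\xi\in\Sigma,\ |\xi\bar\xi|=\pi\}$. A tripod is a triple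 of points with pairwise distances $\pi$. A point $p$ is strongly extremal if for every direction in $\Sigma_p$ there exists a tripod in $\Sigma_p$ containing that direction. A point $p$ is maximally extremal if $\overline{|\xi\eta|}=\pi$ for any two directions $\xi,\eta\in\Sigma_p$. *)

(* Defs.v *)
From HB Require Import structures.
From mathcomp Require Import all_boot all_order all_algebra.
From mathcomp Require Import all_classical all_reals all_analysis.
From mathcomp Require Import ring lra.

Set Implicit Arguments.
Unset Strict Implicit.
Unset Printing Implicit Defensive.

Import Order.TTheory GRing.Theory Num.Theory.
Import numFieldNormedType.Exports.

Local Open Scope classical_set_scope.
Local Open Scope ring_scope.

Section Geodesics.
Context {R : realType} {X : metricType R}.

(* Paths are parametrized by arc length, as functions on the whole of [R] whose
   values outside the interval at hand are junk. *)
Definition isometric_on (I : set R) (c : R -> X) : Prop :=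
  forall s t, I s -> I t -> mdist (c s) (c t) = `|s - t|.

Definition shortest_path (x y : X) (c : R -> X) : Prop :=
  [/\ c 0 = x, c (mdist x y) = y & isometric_on `[0, mdist x y] c].

Definition geodesic_on (I : set R) (c : R -> X) : Prop :=
  forall t, I t -> exists2 e : R, 0 < e & isometric_on (I `&` ball t e) c.

End Geodesics.

Section Sphere.
Context {R : realType}.

Definition dotmul3 (u v : 'rV[R]_3) : R := (u *m v^T) 0 0.

Definition sphere2 : set 'rV[R]_3 := [set u | dotmul3 u u = 1].

Definition sphere_dist (u v : 'rV[R]_3) : R := acos (dotmul3 u v).

End Sphere.

Section GCAT1.
Context {R : realType}.

(* The two points compared are taken on the two sides issuing from [p]. Since
   [p], [q], [r] and their sides are arbitrary (and a reversed shortest path is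
   a shortest path), this covers any two points on distinct sides of a triangle;
   for two points on the same side there is nothing to compare. *)
Definition thin_triangles (X : metricType R) : Prop :=
  forall (p q r : X) (cpq cpr cqr : R -> X),
    shortest_path p q cpq -> shortest_path p r cpr -> shortest_path q r cqr ->
    mdist p q + mdist q r + mdist p r < 2 * pi ->
  forall p' q' r' : 'rV[R]_3,
    sphere2 p' -> sphere2 q' -> sphere2 r' ->
    sphere_dist p' q' = mdist p q -> sphere_dist q' r' = mdist q r ->
    sphere_dist p' r' = mdist p r ->
  forall (s t : R) (x' y' : 'rV[R]_3),
    0 <= s <= mdist p q -> 0 <= t <= mdist p r ->
    sphere2 x' -> sphere2 y' ->
    sphere_dist p' x' = s -> sphere_dist x' q' = mdist p q - s ->
    sphere_dist p' y' = t -> sphere_dist y' r' = mdist p r - t ->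
    mdist (cpq s) (cpr t) <= sphere_dist x' y'.

Definition complete_space (X : metricType R) : Prop :=
  forall F : set_system X, ProperFilter F -> cauchy F -> exists x : X, F --> x.

Definition separable_space (X : metricType R) : Prop :=
  exists2 A : set X, countable A & dense A.

Definition CAT1 (X : metricType R) : Prop :=
  [/\ complete_space X,
      forall x y : X, mdist x y < pi -> exists c, shortest_path x y c
    & thin_triangles X].

Definition geodesically_complete (X : metricType R) : Prop :=
  forall (a b : R) (c : R -> X), a < b -> geodesic_on `[a, b] c ->
  exists2 c' : R -> X, geodesic_on [set: R] c'
    & forall t, a <= t <= b -> c' t = c t.

Definition GCAT1 (X : metricType R) : Prop :=
  [/\ CAT1 X, separable_space X, locally_compact [set: X]
    & geodesically_complete X].

End GCAT1.

Section HausdorffDimension.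
Context {R : realType} {X : metricType R}.
Local Open Scope ereal_scope.

(* [maxe 0] only matters for the empty set. *)
Definition diameter (A : set X) : \bar R :=
  maxe 0 (ereal_sup [set (mdist xy.1 xy.2)%:E | xy in A `*` A]).

Definition hausdorff_content (s delta : R) (A : set X) : \bar R :=
  ereal_inf [set \sum_(0 <= i <oo) diameter (U i) `^ s
    | U in [set U : (set X)^nat | A `<=` \bigcup_i U i /\
                                  forall i, diameter (U i) <= delta%:E]].

Definition hausdorff_measure (s : R) (A : set X) : \bar R :=
  ereal_sup [set hausdorff_content s delta A | delta in `]0%R, +oo[].

(* [hausdorff_measure s A] is nonincreasing in [s], so leaving out the exponent
   0 does not change the infimum (for [s = 0] the library's 0 `^ 0 = 1 would make
   the empty set count). *)
Definition hausdorff_dim (A : set X) : \bar R :=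
  ereal_inf [set s%:E | s in [set s : R | (0 < s)%R /\
                                          hausdorff_measure s A = 0]].

End HausdorffDimension.

Section SpaceOfDirections.
Context {R : realType} {X : metricType R}.

Definition comparison_angle (p x y : X) : R :=
  acos ((mdist p x ^+ 2 + mdist p y ^+ 2 - mdist x y ^+ 2)
        / (2 * mdist p x * mdist p y)).

Definition starts_at (p : X) (c : R -> X) : Prop :=
  c 0 = p /\ exists2 a : R, 0 < a & geodesic_on `[0, a] c.

(* Alexandrov's (upper) angle: the limit superior, as s, t -> 0+, of the
   comparison angles at c 0 = c' 0. *)
Definition angle (c c' : R -> X) : R :=
  fine (limf_esup
    (fun st : R * R => (comparison_angle (c 0) (c st.1) (c' st.2))%:E)
    (filter_prod 0^'+ 0^'+)).

Definition direction_class (p : X) (c : R -> X) : set (R -> X) :=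
  [set c' | starts_at p c' /\ angle c c' = 0].

(* Equivalence classes of geodesics starting at [p], two geodesics being
   equivalent if they make the angle 0. No completion is taken: in a GCAT space
   this space is already complete. The angles take values in [0, pi]. *)
Definition directions (p : X) : Type :=
  {D : set (R -> X) | exists2 c, starts_at p c & D = direction_class p c}.

Definition direction_rep (p : X) (D : directions p) : R -> X :=
  projT1 (cid2 (svalP D)).

Definition angle_dist (p : X) (D E : directions p) : R :=
  angle (direction_rep D) (direction_rep E).

End SpaceOfDirections.

Section Extremal.
Context {R : realType}.

Definition tripod (S : Type) (d : S -> S -> R) (x y z : S) : Prop :=
  [/\ d x y = pi, d y z = pi & d x z = pi].

(* [r] is max_x (d xi x + d eta x) - pi; the maximum is required to exist. *)
Definition is_antipodal_dist (S : Type) (d : S -> S -> R) (xi eta : S) (r : R) :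
    Prop :=
  (exists x, d xi x + d eta x - pi = r) /\
  (forall x, d xi x + d eta x - pi <= r).

Definition strongly_extremal (X : metricType R) (p : X) : Prop :=
  forall xi : directions p, exists eta zeta : directions p,
    tripod (@angle_dist R X p) xi eta zeta.

Definition maximally_extremal (X : metricType R) (p : X) : Prop :=
  forall xi eta : directions p,
    is_antipodal_dist (@angle_dist R X p) xi eta pi.

End Extremal.

Definition rescale (R : realType) (lambda : {posnum R}) (T : Type) : Type := T.

Section Rescale.
Context {R : realType} (lambda : {posnum R}) (T : metricType R).

Definition rescale_dist (x y : rescale lambda T) : R :=
  lambda%:num * @mdist R T x y.

Lemma rescale_distxx x : rescale_dist x x = 0.
Proof. by rewrite /rescale_dist mdistxx mulr0. Qed.

Lemma rescale_dist_positivity x y : rescale_dist x y = 0 -> x = y.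
Proof.
move=> /eqP; rewrite mulf_eq0 gt_eqF//= => /eqP.
exact: mdist_positivity.
Qed.

Lemma rescale_dist_sym x y : rescale_dist x y = rescale_dist y x.
Proof. by rewrite /rescale_dist metric_sym. Qed.

Lemma rescale_dist_triangle y x z :
  rescale_dist x z <= rescale_dist x y + rescale_dist y z.
Proof. by rewrite /rescale_dist -mulrDr ler_pM2l// metric_triangle. Qed.

HB.instance Definition _ := Choice.copy (rescale lambda T) T.
HB.instance Definition _ := @isMetric.Build R (rescale lambda T) rescale_dist
  rescale_distxx rescale_dist_positivity rescale_dist_sym rescale_dist_triangle.

End Rescale.

(* The cone is ([0, +oo[ * T) / ({0} * T): its vertex, and a point (t, x) for
   every t > 0 and x in T. *)
Inductive cone (R : realType) (T : Type) : Type :=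
| vertex
| cone_point of {posnum R} & T.
Arguments vertex {R T}.
Arguments cone_point {R T}.

Section LawOfCosines.
Context {R : realType}.
Implicit Types a b c : R.

(* The third side of a planar triangle with sides a, b enclosing theta. *)
Definition law_of_cosines a b (theta : R) : R :=
  Num.sqrt (a ^+ 2 + b ^+ 2 - 2 * a * b * cos theta).

Lemma law_of_cosinesC a b theta :
  law_of_cosines a b theta = law_of_cosines b a theta.
Proof. by rewrite /law_of_cosines; congr Num.sqrt; ring. Qed.

Lemma law_of_cosinespi a b : 0 <= a -> 0 <= b -> law_of_cosines a b pi = a + b.
Proof.
move=> a0 b0; rewrite /law_of_cosines cospi.
rewrite (_ : _ - _ = (a + b) ^+ 2); last by ring.
by rewrite sqrtr_sqr ger0_norm// addr_ge0.
Qed.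

Lemma law_of_cosines_ge a b theta : 0 <= a -> 0 <= b ->
  `|a - b| <= law_of_cosines a b theta.
Proof.
move=> a0 b0; rewrite -sqrtr_sqr ler_wsqrtr// -subr_ge0.
rewrite (_ : _ - _ = 2 * (a * b) * (1 - cos theta)); last by ring.
by rewrite !mulr_ge0// subr_ge0 cos_le1.
Qed.

Lemma law_of_cosines_mono a b theta theta' : 0 <= a -> 0 <= b ->
  0 <= theta -> theta <= theta' -> theta' <= pi ->
  law_of_cosines a b theta <= law_of_cosines a b theta'.
Proof.
move=> a0 b0 t0 tt' t'pi; rewrite ler_wsqrtr// lerD2l lerN2.
rewrite ler_wpM2l ?mulr_ge0//.
move: tt'; rewrite le_eqVlt => /predU1P[->//|tt'].
by rewrite ltW// ltr_cos// in_itv/= ?t0 ?t'pi ?(le_trans _ t'pi) ?(ltW tt')//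
  (le_trans t0)// ltW.
Qed.

Lemma sqrt_minkowski (u1 u2 v1 v2 : R) :
  Num.sqrt ((u1 + v1) ^+ 2 + (u2 + v2) ^+ 2) <=
  Num.sqrt (u1 ^+ 2 + u2 ^+ 2) + Num.sqrt (v1 ^+ 2 + v2 ^+ 2).
Proof.
have U0 : 0 <= u1 ^+ 2 + u2 ^+ 2 by rewrite addr_ge0// sqr_ge0.
have V0 : 0 <= v1 ^+ 2 + v2 ^+ 2 by rewrite addr_ge0// sqr_ge0.
rewrite -[leRHS]ger0_norm ?addr_ge0 ?sqrtr_ge0// -sqrtr_sqr ler_wsqrtr//.
rewrite [leRHS]sqrrD !sqr_sqrtr//.
suff H : u1 * v1 + u2 * v2 <=
    Num.sqrt (u1 ^+ 2 + u2 ^+ 2) * Num.sqrt (v1 ^+ 2 + v2 ^+ 2).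
  rewrite -mulr_natr; nra.
rewrite -sqrtrM// (le_trans (ler_norm _))// -sqrtr_sqr ler_wsqrtr// -subr_ge0.
rewrite (_ : _ - _ = (u1 * v2 - u2 * v1) ^+ 2) ?sqr_ge0//; ring.
Qed.

Lemma law_of_cosinesD a b c alpha beta :
  law_of_cosines a c (alpha + beta) <=
  law_of_cosines a b alpha + law_of_cosines b c beta.
Proof.
have := sqrt_minkowski (a * cos alpha - b) (a * sin alpha)
  (b - c * cos beta) (c * sin beta).
have Ea := cos2Dsin2 alpha; have Eb := cos2Dsin2 beta.
rewrite /law_of_cosines; congr (Num.sqrt _ <= Num.sqrt _ + Num.sqrt _).
- rewrite cosD; transitivity (a ^+ 2 * (cos alpha ^+ 2 + sin alpha ^+ 2) +
    c ^+ 2 * (cos beta ^+ 2 + sin beta ^+ 2) -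
    2 * a * c * (cos alpha * cos beta - sin alpha * sin beta)); first by ring.
  by rewrite Ea Eb !mulr1.
- transitivity (a ^+ 2 * (cos alpha ^+ 2 + sin alpha ^+ 2) + b ^+ 2 -
    2 * a * b * cos alpha); first by ring.
  by rewrite Ea mulr1.
- transitivity (b ^+ 2 + c ^+ 2 * (cos beta ^+ 2 + sin beta ^+ 2) -
    2 * b * c * cos beta); first by ring.
  by rewrite Eb mulr1.
Qed.

Lemma law_of_cosines_triangle a b c alpha beta gamma :
  0 <= a -> 0 <= b -> 0 <= c ->
  0 <= alpha <= pi -> 0 <= beta <= pi -> 0 <= gamma <= pi ->
  gamma <= alpha + beta ->
  law_of_cosines a c gamma <= law_of_cosines a b alpha + law_of_cosines b c beta.
Proof.
move=> a0 b0 c0 /andP[A0 Api] /andP[B0 Bpi] /andP[C0 Cpi] Cle.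
have [ABpi|/ltW ABpi] := leP (alpha + beta) pi.
  apply: le_trans (law_of_cosinesD _ _ _ _ _).
  exact: law_of_cosines_mono.
apply: le_trans (law_of_cosines_mono a0 c0 C0 Cpi (lexx _)) _.
rewrite -[X in law_of_cosines a c X](subrKC alpha).
apply: le_trans (law_of_cosinesD _ b _ _ _) _.
rewrite lerD2l law_of_cosines_mono ?subr_ge0//.
by rewrite lerBlDl.
Qed.

End LawOfCosines.

Section Cone.
Context {R : realType} (T : metricType R).

HB.instance Definition _ := gen_eqMixin (cone R T).
HB.instance Definition _ := gen_choiceMixin (cone R T).

Definition cone_dist (v w : cone R T) : R :=
  match v, w with
  | vertex, vertex => 0
  | vertex, cone_point t _ => t%:num
  | cone_point s _, vertex => s%:num
  | cone_point s x, cone_point t y =>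
      law_of_cosines s%:num t%:num (Num.min (mdist x y) pi)
  end.

Let min_bnd (x y : T) : 0 <= Num.min (mdist x y) pi <= pi.
Proof. by rewrite le_min mdist_ge0 pi_ge0/= ge_min lexx orbT. Qed.

Lemma cone_distxx v : cone_dist v v = 0.
Proof.
case: v => [//|s x] /=; rewrite mdistxx min_l ?pi_ge0// /law_of_cosines cos0.
by rewrite (_ : _ - _ = 0) ?sqrtr0//; ring.
Qed.

Lemma cone_dist_sym v w : cone_dist v w = cone_dist w v.
Proof.
by case: v w => [|s x] [|t y] //=; rewrite law_of_cosinesC metric_sym.
Qed.

Lemma cone_dist_positivity v w : cone_dist v w = 0 -> v = w.
Proof.
case: v w => [|s x] [|t y] //= L0.
- by have : 0 < t%:num by []; rewrite L0 ltxx.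
- by have : 0 < s%:num by []; rewrite L0 ltxx.
have st : s = t.
  apply/val_inj/eqP; rewrite -subr_eq0 -normr_le0/= -L0.
  exact: law_of_cosines_ge.
subst t; congr cone_point; apply: mdist_positivity.
have /andP[m0 mpi] := min_bnd x y.
have : Num.min (mdist x y) pi = 0.
  apply: (@cos_inj R); rewrite ?in_itv/= ?m0 ?lexx ?pi_ge0//.
  rewrite cos0; apply/eqP; rewrite eq_le cos_le1/=.
  move: L0 => /eqP; rewrite /law_of_cosines sqrtr_eq0.
  set k := cos _ => L0; have s0 : 0 < s%:num by [].
  have : s%:num ^+ 2 * (1 - k) <= 0 by move: L0; lra.
  by rewrite pmulr_rle0 ?exprn_gt0// subr_le0.
by rewrite /Num.min; case: ifPn => // _ pi0; have := @pi_gt0 R; rewrite pi0 ltxx.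
Qed.

Lemma cone_dist_triangle w v u :
  cone_dist v u <= cone_dist v w + cone_dist w u.
Proof.
case: v w u => [|a x] [|b y] [|c z] //=.
- by rewrite add0r.
- have : `|b%:num - c%:num| <=
      law_of_cosines b%:num c%:num (Num.min (mdist y z) pi).
    exact: law_of_cosines_ge.
  by rewrite ler_norml => /andP[]; lra.
- by rewrite addr0.
- rewrite -law_of_cosinespi//; apply: law_of_cosines_mono => //;
  by have /andP[] := min_bnd x z.
- have : `|a%:num - b%:num| <=
      law_of_cosines a%:num b%:num (Num.min (mdist x y) pi).
    exact: law_of_cosines_ge.
  by rewrite ler_norml => /andP[]; lra.
- apply: law_of_cosines_triangle => //.
  have T1 := metric_triangle x y z.
  have ? := mdist_ge0 x y; have ? := mdist_ge0 y z; have ? := @pi_ge0 R.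
  rewrite /Num.min; do 3 case: ifPn; rewrite -?leNgt; lra.
Qed.

HB.instance Definition _ := @isMetric.Build R (cone R T) cone_dist
  cone_distxx cone_dist_positivity cone_dist_sym cone_dist_triangle.

End Cone.

(* Main.v *)
Require Import Defs.
From mathcomp Require Import all_boot all_order all_algebra.
From mathcomp Require Import all_classical all_reals all_analysis.
From mathcomp Require Import ring lra.

Import Order.TTheory GRing.Theory Num.Theory.
Local Open Scope classical_set_scope.
Local Open Scope ring_scope.

(** The proof has a metric half, on Sigma, and an identification of the
    directions at the vertex of a cone.

    A geodesic leaving the vertex is radial for a short time
    ([starts_at_vertex_radial]), and the angle between the radial geodesics
    towards [x] and [y] is [min (d x y) pi], because all the comparison angles
    have that value ([angle_radial]). So the directions at the vertex of the
    cone over [lambda Sigma] are the points of Sigma, with the distance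
    [min (lambda d) pi], and the claims become: if [lambda >= 3/2], every point
    lies in a triple with pairwise distances at least [pi / lambda], for which
    [2 pi / 3] suffices ([exists_tripod]); if [lambda >= 2], for any two points
    some third point is at distance at least [pi / 2] from both
    ([exists_far_point]).

    The fact behind both is that a local geodesic of length at most [pi] in a
    CAT(1) space is a shortest path ([geodesic_dist]). Hence a complete geodesic
    [c] through [x = c 0] satisfies [d (c s) (c t) = |s - t|] as long as this is
    at most [pi], and the triangle inequality does the rest:

    - [c (2 pi / 3)] and [c (- 2 pi / 3)] are at distance [2 pi / 3] from [x],
      and at distance at least [pi - pi / 3] from each other, as one sees by
      passing through [c (- pi / 3)];
    - [c (pi / 2)] and [c (3 pi / 2)] are at distance at least [pi / 2] from
      [x], and [pi] from each other, so any [y] is at distance at least [pi / 2]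
      from one of them.

    A complete geodesic passes through every point that is not isolated. An
    isolated point is at distance at least [pi] from all the others, so there
    the claims follow from a pair of non-isolated points at distance [pi], which
    exists since a space of dimension at least 1 is not discrete
    ([antipodal_pair]). *)

(** * Comparison triangles in the sphere *)

(** The point at distance [s] from the north pole, on the meridian whose
    longitude has cosine [k]. A triangle with its apex at the pole has its two
    sides on the meridians [1] and [k], where [k] is the cosine of its angle; so
    this angle itself never has to be named. *)
Definition sphere_pt {R : realType} (k s : R) : 'rV[R]_3 :=
  \row_(i < 3) [:: sin s * k; sin s * Num.sqrt (1 - k ^+ 2); cos s]`_i.

Lemma dotmul_sphere_pt {R : realType} (j k s t : R) :
  dotmul3 (sphere_pt j s) (sphere_pt k t) =
  sin s * sin t * (j * k + Num.sqrt (1 - j ^+ 2) * Num.sqrt (1 - k ^+ 2)) +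
  cos s * cos t.
Proof.
rewrite /dotmul3 !mxE !big_ord_recl big_ord0 !mxE /=; ring.
Qed.

Lemma dotmul_meridian {R : realType} (k s t : R) : -1 <= k <= 1 ->
  dotmul3 (sphere_pt k s) (sphere_pt k t) = cos (s - t).
Proof.
move=> /andP[k1 k2]; rewrite dotmul_sphere_pt -expr2 -expr2 sqr_sqrtr; last nra.
by rewrite subrKC mulr1 cosB addrC.
Qed.

Lemma sphere_pt_sphere {R : realType} (k s : R) : -1 <= k <= 1 ->
  sphere2 (sphere_pt k s).
Proof. by move=> k1; rewrite /sphere2/= dotmul_meridian// subrr cos0. Qed.

Lemma sphere_dist_meridian {R : realType} (k s t : R) : -1 <= k <= 1 ->
  0 <= s - t <= pi -> sphere_dist (sphere_pt k s) (sphere_pt k t) = s - t.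
Proof. by move=> k1 st; rewrite /sphere_dist dotmul_meridian// cosK. Qed.

Lemma sphere_distC {R : realType} (u v : 'rV[R]_3) :
  sphere_dist u v = sphere_dist v u.
Proof.
rewrite /sphere_dist /dotmul3; congr acos; rewrite !mxE.
by apply: eq_bigr => i _; rewrite !mxE mulrC.
Qed.

Lemma dotmul_hinge {R : realType} (k s t : R) :
  dotmul3 (sphere_pt 1 s) (sphere_pt k t) = sin s * sin t * k + cos s * cos t.
Proof. by rewrite dotmul_sphere_pt expr1n subrr sqrtr0 mul0r addr0 mul1r. Qed.

Lemma sphere_pt0 {R : realType} (k : R) : sphere_pt k 0 = sphere_pt 1 0.
Proof. by rewrite /sphere_pt sin0 !mul0r. Qed.

(** The spherical law of cosines, solved for the cosine [k] of the angle: the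
    triangle inequalities say that [cos l] lies between [cos (A + B)] and
    [cos (A - B)], that is, that [k] lies between -1 and 1. *)
Lemma spherical_hinge {R : realType} (A B l : R) :
  0 < A -> 0 < B -> A + B < pi -> `|A - B| <= l -> l <= A + B ->
  exists2 k : R, -1 <= k <= 1 & cos l = sin A * sin B * k + cos A * cos B.
Proof.
move=> A0 B0 AB; rewrite ler_norml => /andP[l1 l2] l3.
have sA : 0 < sin A by apply: sin_gt0_pi; rewrite A0/=; lra.
have sB : 0 < sin B by apply: sin_gt0_pi; rewrite B0/=; lra.
have sAB := mulr_gt0 sA sB.
have cosle (x y : R) : 0 <= x -> x <= y -> y <= pi -> cos y <= cos x.
  move=> x0 xy y1.
  by rewrite leNgt ltr_cos -?leNgt ?in_itv//= ?x0 ?y1 ?andbT; lra.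
have c1 : cos (A + B) <= cos l by apply: cosle; lra.
have c2 : cos l <= cos (A - B).
  have [AB0|AB0] := leP 0 (A - B); first by apply: cosle; lra.
  by rewrite -[A - B]opprK cosN; apply: cosle; lra.
move: c1 c2; rewrite cosD cosB => c1 c2.
exists ((cos l - cos A * cos B) / (sin A * sin B)).
  by rewrite ler_pdivlMr// ler_pdivrMr//; apply/andP; split; lra.
by rewrite mulrCA divff ?gt_eqF// mulr1 subrK.
Qed.

(** * Local geodesics of length at most pi are shortest *)

Lemma isometric_onS {R : realType} {X : metricType R} (I J : set R) (c : R -> X) :
  I `<=` J -> isometric_on J c -> isometric_on I c.
Proof. by move=> IJ H s t Is It; apply: H; apply: IJ. Qed.

(** The two pieces meet at [t] at the angle [pi], because [c] is isometric on a
    neighbourhood of [t]; in the comparison triangle the angle cannot be smaller,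
    so this triangle is degenerate. Precisely, the points of the sides at
    distance [s] from [c t] are [2 s] apart. In the comparison triangle, with
    angle of cosine [k] at the apex, the cosine of their distance is
    [k sin^2 s + cos^2 s], and thinness makes this at most
    [cos (2 s) = - sin^2 s + cos^2 s], whence [k = -1]. *)
Lemma geodesic_concat {R : realType} {X : metricType R} (c : R -> X)
    (a t v h : R) : CAT1 X -> a < t -> t < v -> v - a < pi ->
  0 < h -> isometric_on `[a, t] c -> isometric_on `[t - h, v] c ->
  mdist (c a) (c v) = v - a.
Proof.
move=> [_ Xgeo Xthin] at_ tv va h0 iso1 iso2.
have pi0 := @pi_gt0 R.
have dat : mdist (c t) (c a) = t - a.
  by rewrite iso1/= ?in_itv/= ?lexx ?ltW// gtr0_norm ?subr_gt0.
have dtv : mdist (c t) (c v) = v - t.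
  by rewrite metric_sym iso2/= ?in_itv/= ?gtr0_norm ?subr_gt0//; lra.
have T1 := metric_triangle (c a) (c t) (c v).
have T2 := metric_triangle (c t) (c a) (c v).
have T3 := metric_triangle (c t) (c v) (c a).
move: T1 T2 T3; rewrite (metric_sym (c v)) (metric_sym _ (c t)) dat dtv.
set l := mdist (c a) (c v) => T1 T2 T3.
have [||||| k k1 kE] := @spherical_hinge R (t - a) (v - t) l; try lra.
  by rewrite ler_norml; lra.
have [cav cavP] := Xgeo (c a) (c v) ltac:(rewrite -/l; lra).
have cta : shortest_path (c t) (c a) (fun u => c (t - u)).
  split; rewrite ?dat; [congr c; ring | congr c; ring | move=> x y].
  rewrite /= !in_itv/= => x1 y1; rewrite iso1/= ?in_itv/=; try lra.
  by rewrite distrC; congr `|_|; ring.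
have ctv : shortest_path (c t) (c v) (fun u => c (t + u)).
  split; rewrite ?dtv; [congr c; ring | congr c; ring | move=> x y].
  rewrite /= !in_itv/= => x1 y1; rewrite iso2/= ?in_itv/=; try lra.
  by congr `|_|; ring.
(* Small enough for c to be isometric on [t - s, t + s]. *)
set s := Num.min h (Num.min (t - a) (v - t)).
have s0 : 0 < s by rewrite !lt_min h0 !subr_gt0 at_ tv.
have [sh sa sv] : [/\ s <= h, s <= t - a & s <= v - t].
  by rewrite !ge_min !lexx !orbT.
have one : -1 <= (1 : R) <= 1 by lra.
have := Xthin _ _ _ _ _ _ cta ctv cavP.
rewrite dat dtv -/l => /(_ ltac:(lra) (sphere_pt 1 0) (sphere_pt 1 (t - a))
  (sphere_pt k (v - t))) /(_ (sphere_pt_sphere _ _ one)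
  (sphere_pt_sphere _ _ one) (sphere_pt_sphere _ _ k1)).
have mer (j x y : R) : -1 <= j <= 1 -> 0 <= x <= y -> y <= pi ->
    sphere_dist (sphere_pt j x) (sphere_pt j y) = y - x.
  by move=> j1 xy y1; rewrite sphere_distC sphere_dist_meridian//; lra.
rewrite mer ?subr0//; try lra.
rewrite -(sphere_pt0 k) mer ?subr0//; try lra.
have l0 : 0 <= l by exact: mdist_ge0.
have -> : sphere_dist (sphere_pt 1 (t - a)) (sphere_pt k (v - t)) = l.
  by rewrite /sphere_dist dotmul_hinge -kE cosK// in_itv/=; lra.
move=> /(_ erefl erefl erefl s s (sphere_pt 1 s) (sphere_pt k s)).
rewrite mer ?(sphere_pt0 k) ?mer ?subr0//; try lra.
rewrite -(sphere_pt0 k) mer ?subr0//; try lra.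
move=> /(_ ltac:(lra) ltac:(lra) (sphere_pt_sphere _ _ one)
  (sphere_pt_sphere _ _ k1) erefl erefl erefl erefl).
rewrite iso2/= ?in_itv/=; try lra.
have -> : `|t - s - (t + s)| = s + s.
  by rewrite ltr0_norm; [ring | lra].
have ss : 0 < sin s by apply: sin_gt0_pi; lra.
have cs := cos2Dsin2 s.
have := @acos_def R (sin s * sin s * k + cos s * cos s).
rewrite /sphere_dist dotmul_hinge => /(_ _)[]; first by nra.
set al := acos _ => al1 al2 sal.
have c1 : cos al <= cos (s + s).
  by rewrite leNgt ltr_cos -?leNgt// ?in_itv/=; lra.
have kN1 : k <= -1.
  have s2 : 0 < sin s * sin s by rewrite mulr_gt0.
  by move: c1; rewrite al2 cosD; nra.
have {k1 kN1}kE1 : k = -1 by lra.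
apply/eqP; rewrite eq_le; apply/andP; split; first lra.
have : cos l <= cos (v - a).
  rewrite kE kE1 (_ : v - a = (t - a) + (v - t)); last ring.
  by rewrite (cosD (t - a)); lra.
by rewrite leNgt ltr_cos -?leNgt// ?in_itv/=; lra.
Qed.

Lemma isometric_on_le {R : realType} {X : metricType R} (I : set R) (c : R -> X) :
  (forall s t, I s -> I t -> s <= t -> mdist (c s) (c t) = t - s) ->
  isometric_on I c.
Proof.
move=> H s t Is It; have [st|/ltW ts] := leP s t.
  by rewrite H// distrC ger0_norm// subr_ge0.
by rewrite metric_sym H// ger0_norm// subr_ge0.
Qed.

Lemma isometric_on_itv {R : realType} {X : metricType R} (a b s t : R)
    (c : R -> X) : isometric_on `[a, b] c -> a <= s -> s <= t -> t <= b ->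
  mdist (c s) (c t) = t - s.
Proof.
move=> iso as_ st tb; rewrite iso /= ?in_itv /= ?as_ ?(le_trans st)//.
  by rewrite distrC ger0_norm// subr_ge0.
by rewrite tb (le_trans as_).
Qed.

Lemma isometric_glue {R : realType} {X : metricType R} (c : R -> X)
    (a t v h : R) : CAT1 X -> a < t -> t <= v -> v - a < pi -> 0 < h ->
  isometric_on `[a, t] c -> isometric_on `[t - h, v] c ->
  isometric_on `[a, v] c.
Proof.
move=> XC at_ tv va h0 iso1 iso2; apply: isometric_on_le => s u.
rewrite /= !in_itv/= => /andP[as_ sv] /andP[au uv] su.
have [ut|tu] := leP u t; first exact: isometric_on_itv iso1 _ _ _.
have [ts|st] := leP t s.
  by apply: (isometric_on_itv _ _ _ _ _ iso2) => //; lra.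
have dau : mdist (c a) (c u) = u - a.
  apply: (geodesic_concat c a t u h XC) => //; first lra.
  by apply: isometric_onS iso2 => w; rewrite /= !in_itv/=; lra.
have das := isometric_on_itv _ _ _ _ _ iso1 (lexx a) as_ (ltW st).
have dst := isometric_on_itv _ _ _ _ _ iso1 as_ (ltW st) (lexx t).
have dtu : mdist (c t) (c u) = u - t.
  by apply: (isometric_on_itv _ _ _ _ _ iso2) => //; lra.
have := metric_triangle (c a) (c s) (c u).
have := metric_triangle (c s) (c t) (c u).
rewrite dau das dst dtu => ? ?.
by apply/eqP; rewrite eq_le; apply/andP; split; lra.
Qed.

(** Continuity: the supremum of the [t] up to which [c] is isometric has a
    neighbourhood on which [c] is isometric, so [isometric_glue] passes beyond it
    unless it is [b]. *)
Lemma geodesic_isometric {R : realType} {X : metricType R} (c : R -> X)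
    (a b : R) : CAT1 X -> geodesic_on [set: R] c -> a <= b -> b - a < pi ->
  isometric_on `[a, b] c.
Proof.
move=> XC cgeo ab bapi.
pose E := [set t | a <= t <= b /\ isometric_on `[a, t] c].
have Ea : E a.
  split; first by rewrite lexx.
  move=> s t; rewrite /= !in_itv/= => /le_anti <- /le_anti <-.
  by rewrite mdistxx subrr normr0.
have Eb : has_sup E.
  by split; [exists a | exists b => t [/andP[]]].
have [e e0 iso2] := cgeo (sup E) I.
have supEb : sup E <= b by apply: sup_le_ub; [exists a | move=> t [/andP[]]].
have asup : a <= sup E by apply: (ub_le_sup Eb.2).
pose v := Num.min b (sup E + e / 2).
have vb : v <= b by rewrite ge_min lexx.
have ve : v <= sup E + e / 2 by rewrite ge_min lexx orbT.
have supv : sup E <= v by rewrite le_min supEb/=; lra.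
have isov w : sup E - e < w -> isometric_on `[w, v] c.
  move=> we; apply: isometric_onS iso2 => x /=; rewrite in_itv/= => x1.
  by split=> //; rewrite /ball/= ltr_norml; lra.
suff Ev : E v.
  have : v <= sup E by apply: (ub_le_sup Eb.2).
  rewrite ge_min; move=> /orP[bsup|]; last lra.
  by have -> : b = v; [lra | exact: Ev.2].
split; first by rewrite vb andbT; lra.
(* If a itself lies in the neighbourhood there is nothing to glue (and t could
   be equal to a below). *)
have [ae|ae] := ltP (sup E - e / 2) a; first by apply: isov; lra.
have [t Et te] := sup_adherent (divr_gt0 e0 (ltr0n _ 2)) Eb.
have tsup : t <= sup E by apply: (ub_le_sup Eb.2).
apply: (isometric_glue c a t v (e / 4) XC) => //; try lra; first exact: Et.2.
by apply: isov; lra.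
Qed.

(** The comparison of triangles requires perimeters less than [2 pi], hence
    lengths less than [pi]; the length [pi] itself is a limit case, reached by
    leaving out a last piece of length [h]. *)
Lemma geodesic_dist {R : realType} {X : metricType R} (c : R -> X)
    (s t : R) : CAT1 X -> geodesic_on [set: R] c -> `|s - t| <= pi ->
  mdist (c s) (c t) = `|s - t|.
Proof.
move=> XC cgeo.
wlog st : s t / s <= t => [hwlog|].
  have [|/ltW] := leP s t; first exact: hwlog.
  by move=> /hwlog h; rewrite metric_sym distrC; exact: h.
rewrite distrC ger0_norm ?subr_ge0// => tspi.
have [tsl|tsl] := ltP (t - s) pi.
  exact: (isometric_on_itv _ _ _ _ _ (geodesic_isometric c s t XC cgeo st tsl)).
have {tspi tsl}tsE : t - s = pi by apply/eqP; rewrite eq_le tspi.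
have pi0 := @pi_gt0 R.
have near_t (e : R) : 0 < e -> e < pi ->
    mdist (c s) (c (t - e)) = t - s - e /\ mdist (c (t - e)) (c t) = e.
  move=> e0 epi; split.
    rewrite (isometric_on_itv s (t - e)); [ring | | lra ..].
    by apply: geodesic_isometric => //; lra.
  rewrite (isometric_on_itv (t - e) t); [ring | | lra ..].
  by apply: geodesic_isometric => //; lra.
apply/eqP; rewrite eq_le; apply/andP; split; apply/ler_addgt0Pr => e e0;
  set h := Num.min (e / 2) (pi / 2);
  (have h0 : 0 < h by rewrite lt_min; lra);
  (have hpi : h < pi by rewrite gt_min; apply/orP; right; lra);
  (have he : h <= e / 2 by rewrite ge_min lexx);
  have [d1 d2] := near_t h h0 hpi.
  by have := metric_triangle (c s) (c (t - h)) (c t); rewrite d1 d2; lra.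
have := metric_triangle (c s) (c t) (c (t - h)).
by rewrite (metric_sym (c t)) d1 d2; lra.
Qed.

(** * Isolated points and dimension *)

(** In a CAT(1) space this is the same as being an isolated point, since points
    at distance less than [pi] are joined by a path. *)
Definition pi_isolated {R : realType} {X : metricType R} (x : X) :=
  forall y : X, y != x -> pi <= mdist x y.

Lemma pi_isolated_far {R : realType} {X : metricType R} (x y : X) :
  pi_isolated x -> ~ pi_isolated y -> pi <= mdist x y.
Proof.
move=> xiso yiso; apply: (xiso y); apply/eqP => yx.
by rewrite yx in yiso.
Qed.

(** A shortest path from [x] to a point at distance less than [pi] extends, by
    geodesic completeness. *)
Lemma line_through {R : realType} {X : metricType R} (x : X) :
  GCAT1 X -> ~ pi_isolated x ->
  exists2 c : R -> X, geodesic_on [set: R] c & c 0 = x.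
Proof.
move=> [[_ Xgeo _] _ _ Xext] /existsNP[y /not_implyP[yx /negP]].
rewrite -ltNge => dpi; have [g [g0 _ giso]] := Xgeo x y dpi.
have d0 : 0 < mdist x y by rewrite mdist_gt0 eq_sym.
have [|c cgeo cE] := Xext 0 (mdist x y) g d0.
  by move=> t _; exists 1 => //; apply: isometric_onS giso => u [].
by exists c => //; rewrite cE// lexx ltW.
Qed.

(** Cover [A] by its points, of diameter 0. The cover is indexed by the values
    of an injection into [nat], so it is by points and empty sets. *)
Lemma hausdorff_measure_countable {R : realType} {X : metricType R} (s : R)
    (A : set X) : 0 < s -> countable A -> hausdorff_measure s A = 0%E.
Proof.
move=> s0 /countable_injP[f finj].
pose U i := [set x | A x /\ f x = i].
have diamU i : diameter (U i) = 0%E.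
  apply/max_idPl; apply: ge_ereal_sup => _ [[x y] /= [[Ax fx] [Ay fy]] <-].
  by rewrite (finj x y) ?inE// ?fx ?fy// mdistxx.
have content0 (delta : R) : 0 < delta -> hausdorff_content s delta A = 0%E.
  move=> delta0; apply/eqP; rewrite eq_le; apply/andP; split.
    apply: ereal_inf_lbound; exists U.
      split=> [x Ax|i]; first by exists (f x).
      by rewrite diamU lee_fin ltW.
    by apply: eseries0 => i _ _; rewrite diamU poweR0r// gt_eqF.
  apply: le_ereal_inf_tmp => _ [V _ <-].
  by apply: nneseries_ge0 => i _ _; exact: poweR_ge0.
rewrite /hausdorff_measure (_ : image _ _ = [set 0%E]) ?ereal_sup1//.
apply/seteqP; split => [_ [delta /= + <-]|_ ->].
  by rewrite in_itv/= andbT => /content0.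
by exists 1; [rewrite /= in_itv/= ltr01 | exact: content0].
Qed.

Lemma hausdorff_dim_countable {R : realType} {X : metricType R} (A : set X) :
  countable A -> (hausdorff_dim A <= 0)%E.
Proof.
move=> Acount; apply/lee_addgt0Pr => e e0; rewrite add0e.
apply: ereal_inf_lbound; exists e => //; split=> //.
exact: hausdorff_measure_countable.
Qed.

(** If all points were isolated, a countable dense set would be the whole
    space. *)
Lemma exists_nonisolated {R : realType} {X : metricType R} :
  GCAT1 X -> (1%:E <= hausdorff_dim [set: X])%E ->
  exists x : X, ~ pi_isolated x.
Proof.
move=> [_ [A Acount Adense] _ _] dim1; apply: contrapT => /forallNP iso.
suff AT : A = [set: X].
  have := le_trans dim1 (hausdorff_dim_countable _ _).
  by rewrite -AT => /(_ Acount); rewrite lee_fin ler10.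
rewrite -subTset => x _.
have xball : open_nbhs x (ball x (pi : R))^°.
  exact: (open_nbhs_ball x (PosNum (pi_gt0 R))).
have [|y [By Ay]] := Adense _ _ xball.1; first by exists x; apply: xball.2.
have : ball x (pi : R) y by exact: interior_subset By.
rewrite ballEmdist/= => xy; have /contrapT/(_ y) := iso x.
by have [<-//|yx /(_ isT)] := eqVneq y x; rewrite leNgt xy.
Qed.

(** * Distant points along a geodesic *)

Lemma tripod_of_line {R : realType} {X : metricType R} (c : R -> X) :
  CAT1 X -> geodesic_on [set: R] c -> exists y z : X,
  [/\ 2 * pi / 3 <= mdist (c 0) y, 2 * pi / 3 <= mdist y z
    & 2 * pi / 3 <= mdist (c 0) z].
Proof.
move=> XC cgeo; have pi0 := @pi_gt0 R.
have dE s t : 0 <= s - t <= pi -> mdist (c s) (c t) = s - t.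
  by move=> /andP[st stpi]; rewrite geodesic_dist// ger0_norm.
exists (c (2 * pi / 3)), (c (- (2 * pi / 3))); split.
- by rewrite metric_sym dE; lra.
- have := metric_triangle (c (2 * pi / 3)) (c (- (2 * pi / 3))) (c (- (pi / 3))).
  have d1 := dE (2 * pi / 3) (- (pi / 3)) ltac:(lra).
  have d2 := dE (- (pi / 3)) (- (2 * pi / 3)) ltac:(lra).
  by rewrite d1 (metric_sym (c (- (2 * pi / 3)))) d2; lra.
- by rewrite dE; lra.
Qed.

(** [y] cannot be closer than [pi / 2] to both [c (pi / 2)] and [c (3 pi / 2)],
    which are at distance [pi]. The latter point may be closer to [c 0] than
    [3 pi / 2], but not closer than [pi - pi / 2]. *)
Lemma far_point_of_line {R : realType} {X : metricType R} (c : R -> X) (y : X) :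
  CAT1 X -> geodesic_on [set: R] c ->
  exists2 x : X, pi / 2 <= mdist (c 0) x & pi / 2 <= mdist y x.
Proof.
move=> XC cgeo; have pi0 := @pi_gt0 R.
have dE s t : 0 <= s - t <= pi -> mdist (c s) (c t) = s - t.
  by move=> /andP[st stpi]; rewrite geodesic_dist// ger0_norm.
have d13 := dE (3 * pi / 2) (pi / 2) ltac:(lra).
have d01 := dE (pi / 2) 0 ltac:(lra).
have d03 := metric_triangle (c (3 * pi / 2)) (c 0) (c (pi / 2)).
have dy := metric_triangle (c (3 * pi / 2)) y (c (pi / 2)).
rewrite (metric_sym (c (3 * pi / 2)) (c 0)) (metric_sym (c 0) (c (pi / 2))) in d03.
rewrite (metric_sym (c (3 * pi / 2)) y) in dy.
have [y1|y1] := leP (pi / 2) (mdist y (c (pi / 2))).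
  by exists (c (pi / 2)) => //; rewrite metric_sym; lra.
by exists (c (3 * pi / 2)); lra.
Qed.

Lemma line_nonisolated {R : realType} {X : metricType R} (c : R -> X) (t : R) :
  CAT1 X -> geodesic_on [set: R] c -> ~ pi_isolated (c t).
Proof.
move=> XC cgeo; have pi0 := @pi_gt0 R => /(_ (c (t + pi / 2))).
rewrite eq_sym -mdist_gt0 geodesic_dist// (_ : t - _ = - (pi / 2)); try ring.
  rewrite normrN gtr0_norm; lra.
rewrite normrN gtr0_norm; lra.
Qed.

(** For use at isolated points, from which both points of the pair are at
    distance at least [pi]. *)
Lemma antipodal_pair {R : realType} {X : metricType R} :
  GCAT1 X -> (1%:E <= hausdorff_dim [set: X])%E ->
  exists y z : X, [/\ ~ pi_isolated y, ~ pi_isolated z & mdist y z = pi].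
Proof.
move=> XG dim1; have XC : CAT1 X by case: XG.
have [w wiso] := exists_nonisolated XG dim1.
have [c cgeo _] := line_through w XG wiso.
exists (c 0), (c pi); split; [exact: line_nonisolated.. |].
by rewrite geodesic_dist// sub0r normrN gtr0_norm// pi_gt0.
Qed.

Lemma exists_tripod {R : realType} {X : metricType R} (x : X) :
  GCAT1 X -> (1%:E <= hausdorff_dim [set: X])%E -> exists y z : X,
  [/\ 2 * pi / 3 <= mdist x y, 2 * pi / 3 <= mdist y z
    & 2 * pi / 3 <= mdist x z].
Proof.
move=> XG dim1; have XC : CAT1 X by case: XG.
have pi0 := @pi_gt0 R.
have [xiso|/line_through[//|c cgeo <-]] := pselect (pi_isolated x); last first.
  exact: tripod_of_line.
have [y [z [yiso ziso yz]]] := antipodal_pair XG dim1.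
have xy := pi_isolated_far x y xiso yiso.
have xz := pi_isolated_far x z xiso ziso.
by exists y, z; rewrite yz; split; lra.
Qed.

Lemma exists_far_point {R : realType} {X : metricType R} (x y : X) :
  GCAT1 X -> (1%:E <= hausdorff_dim [set: X])%E ->
  exists2 z : X, pi / 2 <= mdist x z & pi / 2 <= mdist y z.
Proof.
move=> XG dim1; have XC : CAT1 X by case: XG.
have pi0 := @pi_gt0 R.
have [xiso|/line_through[//|c cgeo <-]] := pselect (pi_isolated x); last first.
  exact: far_point_of_line.
have [yiso|/line_through[//|c cgeo <-]] := pselect (pi_isolated y); last first.
  by have [z ? ?] := far_point_of_line c x XC cgeo; exists z.
have [z [_ [ziso _ _]]] := antipodal_pair XG dim1.
have xz := pi_isolated_far x z xiso ziso.
have yz := pi_isolated_far y z yiso ziso.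
by exists z; lra.
Qed.

(** * Directions at the vertex of a cone *)

Lemma limf_esup_near_cst {T : choiceType} {X : filteredType T} {R : realType}
    (f : X -> \bar R) (F : set_system X) (l : \bar R) :
  ProperFilter F -> (\forall x \near F, f x = l) -> limf_esup f F = l.
Proof.
move=> FF fl; apply/eqP; rewrite eq_le; apply/andP; split.
  apply: ge_ereal_inf; exists (ereal_sup [set f x | x in [set x | f x = l]]).
    by exists [set x | f x = l].
  by apply: ge_ereal_sup => _ [x /= -> <-].
apply: le_ereal_inf_tmp => _ [V FV <-].
have [x [Vx fx]] := filter_ex (filterI FV fl).
by rewrite -fx; apply: ereal_sup_ubound; exists x.
Qed.

Lemma acos_law_of_cosines {R : realType} (a b theta : R) :
  0 < a -> 0 < b -> 0 <= theta <= pi ->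
  acos ((a ^+ 2 + b ^+ 2 - law_of_cosines a b theta ^+ 2) / (2 * a * b)) = theta.
Proof.
move=> a0 b0 th; rewrite /law_of_cosines sqr_sqrtr; last first.
  have ab := mulr_gt0 a0 b0.
  have := cos_le1 theta; have := sqr_ge0 (a - b); nra.
rewrite (_ : _ / _ = cos theta) ?cosK ?in_itv//.
by field; rewrite !gt_eqF.
Qed.

(** The equality case of the triangle inequality for the apex of a planar
    triangle and its two other vertices. *)
Lemma law_of_cosines_eq0 {R : realType} (a b theta : R) :
  0 < a -> 0 < b -> 0 <= theta <= pi -> law_of_cosines a b theta = `|a - b| ->
  theta = 0.
Proof.
move=> a0 b0 th E; rewrite -(acos_law_of_cosines a b theta)// E.
rewrite real_normK ?num_real// (_ : _ / _ = 1) ?acos1//.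
by field; rewrite !gt_eqF.
Qed.

Definition trunc_dist {R : realType} {T : metricType R} (x y : T) : R :=
  Num.min (mdist x y) pi.

Lemma trunc_dist_bounds {R : realType} {T : metricType R} (x y : T) :
  0 <= trunc_dist x y <= pi.
Proof. by rewrite le_min mdist_ge0 pi_ge0/= ge_min lexx orbT. Qed.

Lemma trunc_dist_eq0 {R : realType} {T : metricType R} (x y : T) :
  trunc_dist x y = 0 -> x = y.
Proof.
rewrite /trunc_dist /Num.min; case: ifP => _; first exact: mdist_positivity.
by move=> pi0; have := @pi_gt0 R; rewrite pi0 ltxx.
Qed.

Lemma trunc_dist_pi {R : realType} {T : metricType R} (x y : T) :
  pi <= mdist x y -> trunc_dist x y = pi.
Proof. by move=> /min_idPr. Qed.

(** Only the germ of [c] at 0 matters for its direction, and a geodesic from the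
    vertex is under control only on the interval where it is a shortest path. *)
Definition radial {R : realType} {T : metricType R} (x : T)
    (c : R -> cone R T) :=
  c 0 = vertex /\
  exists2 a : R, 0 < a &
    forall t : {posnum R}, t%:num < a -> c t%:num = cone_point t x.

(** As long as [c] is a shortest path, [c t] is at distance [t] from the vertex,
    and two points at distances [s] and [t] from it are only [|s - t|] apart:
    they have the same coordinate in [T]. *)
Lemma starts_at_vertex_radial {R : realType} {T : metricType R}
    (c : R -> cone R T) : starts_at vertex c -> exists x, radial x c.
Proof.
move=> [c0 [a a0 cgeo]].
have [e e0 ciso] := cgeo 0 ltac:(by rewrite /= in_itv/= lexx ltW).
pose b := Num.min a e.
have b0 : 0 < b by rewrite lt_min a0.
have {}ciso (s t : R) : 0 <= s < b -> 0 <= t < b ->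
    mdist (c s) (c t) = `|s - t|.
  rewrite !lt_min => /and3P[s0 sa se] /and3P[t0 ta te]; apply: ciso.
    by split; rewrite /= ?in_itv/= ?s0 ?(ltW sa)// /ball/= sub0r normrN ger0_norm.
  by split; rewrite /= ?in_itv/= ?t0 ?(ltW ta)// /ball/= sub0r normrN ger0_norm.
have cpt (t : {posnum R}) : t%:num < b -> exists x, c t%:num = cone_point t x.
  move=> tb; have := ciso 0 t%:num; rewrite lexx b0 tb/= c0 => /(_ isT).
  rewrite ge0// sub0r normrN ger0_norm// => /(_ isT).
  case: (c t%:num) => [|t' x] /=; rewrite /mdist/= => tE.
    by have : 0 < t%:num by []; rewrite -tE ltxx.
  by exists x; congr cone_point; exact/val_inj.
pose h : {posnum R} := PosNum (divr_gt0 b0 (ltr0n R 2)).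
have hb : h%:num < b by rewrite /=; lra.
have [x hx] := cpt h hb; exists x; split => //; exists b => // t tb.
have [y ty] := cpt t tb; rewrite ty; congr cone_point.
have := ciso t%:num h%:num; rewrite tb hb hx ty !ge0 => /(_ isT isT) L.
apply: trunc_dist_eq0; apply: (law_of_cosines_eq0 t%:num h%:num) => //.
exact: trunc_dist_bounds.
Qed.

(** The triangles formed by the vertex and two points on the radial geodesics
    are Euclidean by the definition of the cone metric, so their comparison
    angles are constant and no limit is involved. *)
Lemma angle_radial {R : realType} {T : metricType R} (x y : T)
    (c c' : R -> cone R T) : radial x c -> radial y c' ->
  angle c c' = trunc_dist x y.
Proof.
move=> [c0 [a a0 ca]] [c'0 [a' a'0 ca']].
rewrite /angle (@limf_esup_near_cst _ _ _ _ _ (trunc_dist x y)%:E)//.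
exists ([set s | 0 < s < a], [set t | 0 < t < a']).
  by split; near=> s; apply/andP; split; near: s;
    by [exact: nbhs_right_gt | exact: nbhs_right_lt].
move=> [s t] /= [/andP[s0 sa] /andP[t0 ta]].
rewrite /comparison_angle c0 (ca (PosNum s0))// (ca' (PosNum t0))//.
congr EFin.
exact: (acos_law_of_cosines s t _ s0 t0 (trunc_dist_bounds x y)).
Unshelve. all: by end_near. Qed.

Definition ray {R : realType} {T : metricType R} (x : T) (t : R) : cone R T :=
  if insub t is Some u then cone_point u x else vertex.

Lemma ray_pos {R : realType} {T : metricType R} (x : T) (t : {posnum R}) :
  ray x t%:num = cone_point t x.
Proof. by rewrite /ray valK. Qed.

Lemma radial_ray {R : realType} {T : metricType R} (x : T) : radial x (ray x).
Proof.
split.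
  rewrite /ray; case: insubP => //= u _ u0.
  by have : 0 < u%:num by []; rewrite u0 ltxx.
by exists 1 => // t _; exact: ray_pos.
Qed.

Lemma starts_at_ray {R : realType} {T : metricType R} (x : T) :
  starts_at vertex (ray x).
Proof.
have r0 := (radial_ray x).1.
split=> //; exists 1 => //.
move=> u _; exists 1 => // s t [+ _] [+ _]; rewrite /= !in_itv/=.
move=> /andP[+ _] /andP[+ _]; rewrite !le_eqVlt.
move=> /predU1P[<-|s0] /predU1P[<-|t0].
- by rewrite mdistxx subrr normr0.
- by rewrite r0 -[t]/((PosNum t0)%:num) ray_pos /mdist/= sub0r normrN gtr0_norm.
- by rewrite r0 -[s]/((PosNum s0)%:num) ray_pos /mdist/= subr0 gtr0_norm.
- rewrite -[s]/((PosNum s0)%:num) -[t]/((PosNum t0)%:num) !ray_pos /mdist/=.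
  rewrite mdistxx min_l ?pi_ge0// /law_of_cosines cos0 -sqrtr_sqr.
  by congr Num.sqrt; ring.
Qed.

Lemma direction_repP {R : realType} {X : metricType R} (p : X) (D : directions p) :
  starts_at p (direction_rep D) /\ sval D = direction_class p (direction_rep D).
Proof. by rewrite /direction_rep; case: cid2. Qed.

Lemma direction_point {R : realType} {T : metricType R}
    (D : directions (vertex : cone R T)) : exists x, radial x (direction_rep D).
Proof. exact: starts_at_vertex_radial _ (direction_repP _ D).1. Qed.

(** The representative of the class of [ray x] need not be [ray x], but it makes
    the angle 0 with it, so it is radial towards the same point. *)
Lemma point_direction {R : realType} {T : metricType R} (x : T) :
  exists D : directions (vertex : cone R T), radial x (direction_rep D).
Proof.
pose D : directions (vertex : cone R T) := exist _
  (direction_class vertex (ray x)) (ex_intro2 _ _ (ray x) (starts_at_ray x) erefl).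
exists D; have [y yD] := direction_point D.
have : direction_class vertex (ray x) (ray x).
  split; first exact: starts_at_ray.
  rewrite (angle_radial x x); try exact: radial_ray.
  by rewrite /trunc_dist mdistxx min_l ?pi_ge0.
rewrite -[direction_class _ _]/(sval D) (direction_repP _ D).2 => -[_].
by rewrite (angle_radial y x) //; [move=> /trunc_dist_eq0 <- | exact: radial_ray].
Qed.

Lemma angle_dist_radial {R : realType} {T : metricType R} (x y : T)
    (D E : directions (vertex : cone R T)) :
  radial x (direction_rep D) -> radial y (direction_rep E) ->
  angle_dist D E = trunc_dist x y.
Proof. exact: angle_radial. Qed.

Lemma strongly_extremal_vertex {R : realType} (T : metricType R) :
  (forall x : T, exists y z : T,
    [/\ pi <= mdist x y, pi <= mdist y z & pi <= mdist x z]) ->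
  strongly_extremal (vertex : cone R T).
Proof.
move=> tripods xi; have [x xxi] := direction_point xi.
have [y [z [xy yz xz]]] := tripods x.
have [eta yeta] := point_direction y; have [zeta zzeta] := point_direction z.
exists eta, zeta; split.
- by rewrite (angle_dist_radial x y)// trunc_dist_pi.
- by rewrite (angle_dist_radial y z)// trunc_dist_pi.
- by rewrite (angle_dist_radial x z)// trunc_dist_pi.
Qed.

Lemma maximally_extremal_vertex {R : realType} (T : metricType R) :
  (forall x y : T, exists2 z : T, pi <= mdist x z & pi <= mdist y z) ->
  maximally_extremal (vertex : cone R T).
Proof.
move=> far xi eta; have [x xxi] := direction_point xi.
have [y yeta] := direction_point eta; split.
  have [z xz yz] := far x y; have [zeta zzeta] := point_direction z.
  exists zeta; rewrite (angle_dist_radial x z)// (angle_dist_radial y z)//.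
  by rewrite !trunc_dist_pi// addrK.
move=> zeta; have [z zzeta] := direction_point zeta.
rewrite (angle_dist_radial x z)// (angle_dist_radial y z)//.
have /andP[_ xz] := trunc_dist_bounds x z.
have /andP[_ yz] := trunc_dist_bounds y z.
by lra.
Qed.

(** * The extremal vertex *)

Lemma mdist_rescale {R : realType} (lambda : {posnum R}) (T : metricType R)
    (x y : T) :
  mdist (x : rescale lambda T) (y : rescale lambda T) = lambda%:num * mdist x y.
Proof. by []. Qed.

Theorem proposition3p3 (R : realType) (Sigma : metricType R)
    (lambda : {posnum R})
    (Sigma_compact : compact [set: Sigma])
    (Sigma_GCAT1 : GCAT1 Sigma)
    (Sigma_dim : (1%:E <= hausdorff_dim [set: Sigma])%E)
    (lambda_ge1 : 1 <= lambda%:num) :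
  (3 / 2 <= lambda%:num ->
     strongly_extremal (vertex : cone R (rescale lambda Sigma))) /\
  (2 <= lambda%:num ->
     maximally_extremal (vertex : cone R (rescale lambda Sigma))).
Proof.
have pi0 := @pi_gt0 R.
split=> lambda_ge.
  apply: strongly_extremal_vertex => x.
  have [y [z [xy yz xz]]] := exists_tripod (x : Sigma) Sigma_GCAT1 Sigma_dim.
  by exists y, z; rewrite !mdist_rescale; split; nra.
apply: maximally_extremal_vertex => x y.
have [z xz yz] := exists_far_point (x : Sigma) (y : Sigma) Sigma_GCAT1 Sigma_dim.
by exists z; rewrite mdist_rescale; nra.
Qed.
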